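(* Let $k\ge 1$ and $r\ge 1$ be natural numbers, and let $c:[\mathbb{N}]^k\to\{0,\dots,r-1\}$ be an $r$-edge coloring of the complete $k$-uniform hypergraph on the countably infinite vertex set $\mathbb{N}$. Then: (1) $\mathbb{N}$ can be partitioned into monochromatic tight paths, each finite or one-way infinite, of pairwise distinct colors (so at most one path of each color); (2) $\mathbb{N}$ can be partitioned into monochromatic tight cycles and two-way infinite tight paths, of pairwise distinct colors (at most one of these pieces for each color).
   Context: A tight path in a $k$-uniform hypergraph is a finite or one-way infinite sequence of distinct vertices such that every set of $k$ consecutive vertices of the sequence is an edge. A two-way infinite tight path is a $\mathbb{Z}$-indexed sequence of distinct vertices such that every set of $k$ consecutive vertices is an edge; a tight cycle is a finite cyclically ordered sequence of distinct vertices such that every set of $k$ cyclically consecutive vertices is an edge. Such a structure is monochromatic of color $i$ if all the edges formed by $k$ consecutive vertices have color $i$. By convention the empty set and single vertices count as monochromatic paths of any color (so some pieces of a partition may be empty). *)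

(* Defs.v *)
From mathcomp Require Import all_boot all_order all_algebra finmap.
From mathcomp Require Import boolp classical_sets.

Set Implicit Arguments.
Unset Strict Implicit.
Unset Printing Implicit Defensive.

Local Open Scope classical_set_scope.

Definition edge (k : nat) : Type := {e : {fset nat} | #|` e| == k}.

(* The vertex set of s must itself be an edge: s has exactly k distinct entries. *)
Definition edge_of_color (k r : nat) (c : edge k -> 'I_r) (i : 'I_r)
    (s : seq nat) : Prop :=
  exists e : edge k, val e = [fset x in s]%fset /\ c e = i.

Inductive path_piece : Type :=
| FinPath of seq nat
| OneWayPath of (nat -> nat).

Inductive cycle_piece : Type :=
| Cycle of seq nat
| TwoWayPath of (int -> nat).

Definition path_vertices (p : path_piece) : set nat :=
  match p with
  | FinPath s => [set` s]
  | OneWayPath f => range f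
  end.

Definition cycle_vertices (p : cycle_piece) : set nat :=
  match p with
  | Cycle s => [set` s]
  | TwoWayPath f => range f
  end.

(* The disjunct size s <= 1 is the convention that the empty set and single
   vertices are monochromatic paths of every colour; it only matters for a
   single vertex when k = 1. *)
Definition monochromatic_path (k r : nat) (c : edge k -> 'I_r) (i : 'I_r)
    (p : path_piece) : Prop :=
  match p with
  | FinPath s => uniq s /\
      (size s <= 1 \/
       forall n, n + k <= size s ->
         edge_of_color c i (take k (drop n s)))
  | OneWayPath f => injective f /\
      forall n, edge_of_color c i [seq f (n + j) | j <- iota 0 k]
  end.

(* rot n s lists the cyclic sequence s from its n-th vertex on.  If
   0 < size s < k the windows have fewer than k vertices, so they are not
   edges and s is not a cycle; s = [::] is the empty piece. *)
Definition monochromatic_cycle (k r : nat) (c : edge k -> 'I_r) (i : 'I_r)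
    (p : cycle_piece) : Prop :=
  match p with
  | Cycle s => uniq s /\
      forall n, n < size s -> edge_of_color c i (take k (rot n s))
  | TwoWayPath f => injective f /\
      forall z : int,
        edge_of_color c i [seq f (z + j%:Z)%R | j <- iota 0 k]
  end.

(* A partition in which some of the parts may be empty. *)
Definition is_partition (I : Type) (V : I -> set nat) : Prop :=
  \bigcup_i V i = [set: nat] /\ trivIset [set: I] V.

(* Main.v *)
Require Import Defs.
From mathcomp Require Import all_boot all_order all_algebra finmap.
From mathcomp Require Import boolp classical_sets filter zify.

(* A nonprincipal ultrafilter extends the coloring to sets of fewer than k
   vertices: the color of F is the color of F + x for almost all x.  In
   particular every vertex v gets a color, and if X is a set of at most k - 1
   vertices chosen generically one after the other, all after v, then X + v has
   the color of v.  So vertices of color i, separated by blocks of k - 1 vertices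
   which are generic over both of their neighbours, form a tight path of color
   i: every window contains exactly one of them.  All blocks are taken from one
   generic sequence, which is so sparse that between two consecutive terms there
   remain vertices of each color used infinitely often, and which starts after
   the last vertex of each color used finitely often.  The vertices outside the
   blocks of an infinitely used color are then linked in a one-way or a two-way
   infinite path, those of a finitely used color in a cycle. *)

Set Implicit Arguments.
Unset Strict Implicit.
Unset Printing Implicit Defensive.

Local Notation "n %:Z" := (Posz n) (only parsing) : nat_scope.

(** * Ultrafilter limits and the extended coloring *)

Lemma exists_nonprincipal_ultrafilter :
  exists U : set_system nat,
    UltraFilter U /\ forall N, U [set x | N < x]%classic.
Proof.
have [U [UU eU]] := @ultraFilterLemma nat \oo%classic eventually_filter.
exists U; split=> // N; apply: eU; exists N.+1 => //.
Qed.

(** If no fiber of [h] were in [U], all their complements would be, and so would the intersection of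
    these finitely many sets, which is empty. *)
Lemma ultrafilter_pigeonhole (T : Type) (I : finType) (U : set_system T)
    (UU : UltraFilter U) (h : T -> I) :
  exists i, U [set x | h x = i]%classic.
Proof.
have FU := @ultra_proper _ _ UU.
apply: contrapT => nU; suff : U set0 by apply: filter_not_empty.
have all_neq : forall i, U [set x | h x <> i]%classic.
  move=> i; have [Ui|//] := in_ultra_setVsetC [set x | h x = i]%classic UU.
  by case: nU; exists i.
have Uall := @filter_forall T I _ U (@filter_filter _ _ FU) all_neq.
by apply: (filterS _ Uall) => x /(_ (h x)).
Qed.

Definition ultralimit (T : Type) (I : finType) (i0 : I) (U : set_system T)
    (h : T -> I) : I :=
  xget i0 [set i | U [set x | h x = i]]%classic.

Lemma ultralimitP (T : Type) (I : finType) (i0 : I) (U : set_system T)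
    (UU : UltraFilter U) (h : T -> I) :
  U [set x | h x = ultralimit i0 U h]%classic.
Proof. exact: (xgetPex i0 (ultrafilter_pigeonhole UU h)). Qed.

(* The argument [d] stands for [k - #|` F|], the number of vertices over which
   a limit still has to be taken. *)
Fixpoint limit_color (I : finType) (i0 : I) (U : set_system nat)
    (col : {fset nat} -> I) (d : nat) (F : {fset nat}) : I :=
  if d is d'.+1 then
    ultralimit i0 U (fun x => limit_color i0 U col d' (x |` F)%fset)
  else col F.

Definition generic (I : Type) (k : nat) (col : {fset nat} -> I) (N x : nat) :=
  forall F : {fset nat}, (forall y, y \in F -> y <= N) -> #|` F| < k ->
    col (x |` F)%fset = col F.

(** For a fixed [F] with fewer than [k] elements, [col F] is the limit of the colors of the sets
    [F + x], so almost every [x] is as required for this [F]. Only finitely many [F] are bounded by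
    [N], hence almost every [x] suits all of them, and some such [x] exceeds [M] because [U] is
    nonprincipal. *)
Lemma extend_coloring (k r : nat) (hr : 0 < r) (c : edge k -> 'I_r) :
  exists col : {fset nat} -> 'I_r,
    (forall e : edge k, col (val e) = c e) /\
    forall N M, exists x, M < x /\ generic k col N x.
Proof.
have [U [UU Ularge]] := exists_nonprincipal_ultrafilter.
have FU := @ultra_proper _ _ UU.
pose i0 := Ordinal hr.
pose col0 (F : {fset nat}) : 'I_r :=
  if insub F : option (edge k) is Some e then c e else i0.
pose col F := limit_color i0 U col0 (k - #|` F|) F.
exists col; split=> [e|N M].
  by rewrite /col (eqP (valP e)) subnn /= /col0 valK.
have gen1 F : U [set x | #|` F| < k -> col (x |` F)%fset = col F]%classic.
  have [Fk|kF] := ltnP #|` F| k; last by apply: filterS filterT.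
  pose h x := limit_color i0 U col0 (k - #|` F|.+1) (x |` F)%fset.
  have colF : col F = ultralimit i0 U h by rewrite /col -(subnSK Fk).
  (* Beyond the maximum of [F], the vertex [x] is new, so that [x + F] has exactly one limit fewer
     to take. *)
  have Fbig : U [set x | \max_(y <- F) y < x]%classic by exact: Ularge.
  apply: filterS (filterI Fbig (ultralimitP i0 UU h)) => x [/= xbig hx] _.
  rewrite colF -hx.
  have xF : x \notin F.
    apply/negP => xF; move: xbig; rewrite ltnNge.
    by rewrite (@leq_bigmax_seq _ _ xpredT id).
  by rewrite /col cardfsU1 xF add1n.
have gens (Fs : seq {fset nat}) :
    U [set x | forall F, F \in Fs -> #|` F| < k ->
                 col (x |` F)%fset = col F]%classic.
  elim: Fs => [|F Fs IH]; first by apply: filterS filterT.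
  apply: filterS (filterI (gen1 F) IH) => x [xF xFs] F'.
  by rewrite inE => /predU1P[->|/xFs].
have [x [xM xgen]] := filter_ex (filterI (Ularge M)
  (gens (enum_fset (fpowerset [fset y in iota 0 N.+1]%fset)))).
exists x; split=> // F FN; apply: xgen.
rewrite -[_ \in _]/(F \in fpowerset _) fpowersetE; apply/fsubsetP => y /FN yN.
by rewrite !inE mem_iota; lia.
Qed.

(** * Colors of sets drawn from a generic sequence *)

Lemma increasing_leq (g : nat -> nat) (gS : forall n, g n < g n.+1) m n :
  m <= n -> g m <= g n.
Proof.
elim: n => [|n IH]; first by rewrite leqn0 => /eqP ->.
rewrite leq_eqVlt => /predU1P[-> //|/IH mn].
exact: leq_trans mn (ltnW (gS n)).
Qed.

Lemma increasing_inj (g : nat -> nat) (gS : forall n, g n < g n.+1) :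
  injective g.
Proof.
move=> m n gmn; apply/eqP; rewrite eqn_leq; apply/andP.
split; rewrite leqNgt; apply/negP => /(increasing_leq gS);
  move: (gS n) (gS m); lia.
Qed.

(* Peeling off the largest element repeatedly never changes the color. *)
Lemma generic_color (I : Type) (k : nat) (col : {fset nat} -> I)
    (g : nat -> nat) (gS : forall n, g n < g n.+1)
    (ggen : forall n, generic k col (g n) (g n.+1))
    (m v : nat) (E : {fset nat}) :
  v \in E -> v <= g m -> #|` E| <= k ->
  (forall x, x \in E -> x <> v -> exists2 n, m < n & x = g n) ->
  col E = col [fset v]%fset.
Proof.
have [n] := ubnP #|` E|; elim: n E => // n IH E En vE vm Ek Eg.
have [->//|ne] := eqVneq E [fset v]%fset.
have [x xE xmax] : exists2 x, x \in (E `\ v)%fset &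
    forall y, y \in (E `\ v)%fset -> y <= x.
  have [x0 x0E] : exists x0, x0 \in (E `\ v)%fset.
    apply/fset0Pn; apply: contra ne => /eqP E0.
    by rewrite -(fsetD1K vE) E0 fsetU0.
  have eP : exists y, y \in (E `\ v)%fset by exists x0.
  have bP y : y \in (E `\ v)%fset -> y <= \max_(z <- (E `\ v)%fset) z.
    by move=> yE; rewrite (@leq_bigmax_seq _ _ xpredT id).
  by case: (ex_maxnP eP bP) => x xE xmax; exists x.
move: (xE); rewrite !inE => /andP[/eqP xv xE'].
(* The largest element other than [v] is some [g p.+1] with [m <= p]. It is generic over [g p],
   which bounds [v] and all the other elements, so it can be removed. *)
have [[//|p] mp xg] := Eg x xE' xv.
have cardE := cardfsD1 x E; rewrite xE' in cardE.
rewrite -(fsetD1K xE') xg ggen.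
- rewrite -xg; apply: IH => //; try lia.
    by rewrite !inE vE andbT; apply/eqP => /esym.
  by move=> y; rewrite !inE => /andP[_ yE]; apply: Eg.
- move=> y; rewrite !inE => /andP[/eqP yx yE].
  have [->|/eqP yv] := eqVneq y v.
    by apply: leq_trans vm (increasing_leq gS _); lia.
  have yE1 : y \in (E `\ v)%fset by rewrite !inE yE andbT; apply/eqP.
  have [q mq yq] := Eg y yE yv.
  rewrite yq; apply: (increasing_leq gS); rewrite -ltnS ltnNge.
  apply/negP => /(increasing_leq gS); move: (xmax y yE1); rewrite -xg -yq; lia.
- by rewrite -xg; lia.
Qed.

(** * Sparse sequences and enumeration of the color classes *)

Lemma uniform_bound (I : finType) (P : I -> nat -> Prop) :
  (forall i, exists N, P i N) ->
  exists B, forall i, exists2 N, N <= B & P i N.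
Proof.
move=> /choice[f fP]; exists (\max_i f i) => i.
by exists (f i) => //; apply: leq_bigmax.
Qed.

Definition infinite_class (I : Type) (a : nat -> I) (i : I) : Prop :=
  forall N, exists2 x, N < x & a x = i.

(** Greedy construction: [g 0] bounds the finite classes, and each step jumps over a vertex of every
    infinite class. Both need only finitely many bounds, as there are finitely many colors. The
    vertices jumped over keep the infinite classes infinite after the terms of [g] have been given
    to blocks. *)
Lemma exists_spread_sequence (I : finType) (a : nat -> I)
    (P : nat -> nat -> Prop) :
  (forall N M, exists x, M < x /\ P N x) ->
  exists g : nat -> nat,
    [/\ forall n, g n < g n.+1,
        forall n, P (g n) (g n.+1),
        forall i, infinite_class a i ->
          forall n, exists2 x, a x = i & g n < x < g n.+1
      & forall x, ~ infinite_class a (a x) -> x <= g 0].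
Proof.
move=> Pex.
have [g0 g0P] : exists B, forall i, exists2 N, N <= B &
    ~ infinite_class a i -> forall x, a x = i -> x <= N.
  apply: uniform_bound => i.
  have [ii|/existsNP[N NP]] := pselect (infinite_class a i); first by exists 0.
  exists N => _ x axi; rewrite leqNgt; apply/negP => Nx.
  by apply: NP; exists x.
have stepP N : exists y, [/\ N < y, P N y & forall i, infinite_class a i ->
    exists2 x, a x = i & N < x < y].
  have [B BP] : exists B, forall i, exists2 x, x <= B &
      infinite_class a i -> a x = i /\ N < x.
    apply: uniform_bound => i.
    have [ii|ni] := pselect (infinite_class a i); last by exists 0.
    by have [x Nx axi] := ii N; exists x.
  have [y [yB Py]] := Pex N (maxn N B); exists y; split=> // [|i ii].
    by apply: leq_ltn_trans yB; apply: leq_maxl.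
  have [x xB /(_ ii)[axi Nx]] := BP i; exists x => //; rewrite Nx /=.
  by apply: leq_ltn_trans yB; rewrite leq_max xB orbT.
have [step sP] := choice stepP.
exists (fun n => iter n step g0); split=> /=.
- by move=> n; have [] := sP (iter n step g0).
- by move=> n; have [] := sP (iter n step g0).
- by move=> i ii n; have [_ _ /(_ i ii)] := sP (iter n step g0).
- by move=> x nx; have [N Ng /(_ nx x erefl) xN] := g0P (a x); apply: leq_trans Ng.
Qed.

(** The increasing enumeration of [S] keeps pace with [g]: if [w j <= g j.+1], the element of [S] in
    the next gap lies above [w j] and bounds [w j.+1]. This bound decides later which blocks may
    stand next to [w j]. *)
Lemma enumerate_class (S : nat -> Prop) (g : nat -> nat) :
  (forall n, exists2 x, S x & g n < x < g n.+1) ->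
  exists w : nat -> nat,
    [/\ forall j, w j < w j.+1,
        forall j, w j <= g j.+1
      & forall x, S x <-> exists j, x = w j].
Proof.
move=> gap.
pose above N (x : nat) : bool := `[< S x /\ N <= x >].
have aboveP N : exists x, above N x.
  have gS n : g n < g n.+1 by have [x _] := gap n; lia.
  have gn : forall n, n <= g n by elim=> // n IH; move: (gS n); lia.
  have [x Sx /andP[gx _]] := gap N; exists x; apply/asboolP; split=> //.
  by move: (gn N); lia.
pose next N := ex_minn (aboveP N).
have nextP N : [/\ S (next N), N <= next N &
    forall x, S x -> N <= x -> next N <= x].
  rewrite /next; case: ex_minnP => m /asboolP[Sm Nm] mmin; split=> // x Sx Nx.
  by apply: mmin; apply/asboolP.
pose w j := iter j (fun v => next v.+1) (next 0).
have Sw j : S (w j).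
  by case: j => [|j]; [have [] := nextP 0|have [] := nextP (w j).+1].
have wS j : w j < w j.+1 by have [_ ? _] := nextP (w j).+1.
exists w; split=> // [|x].
  elim=> [|j IH].
    have [x Sx /andP[_ xg]] := gap 0; have [_ _ /(_ x Sx)] := nextP 0.
    by rewrite /w /=; lia.
  have [x Sx /andP[gx xg]] := gap j.+1; have [_ _ /(_ x Sx)] := nextP (w j).+1.
  by rewrite /w /= -/(w j); lia.
split=> [Sx|[j -> //]].
have jw : forall j, j <= w j by elim=> // j IH; move: (wS j); lia.
have eP : exists j, x <= w j by exists x.
(* At the least [j] with [x <= w j], equality holds, since [w j] is the first element of [S] after
   the previous term, which is below [x]. *)
case: (ex_minnP eP) => -[|j] xw jmin; [exists 0|exists j.+1].
  by have [_ _ /(_ x Sx)] := nextP 0; rewrite /w /= in xw *; lia.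
have [_ _ /(_ x Sx) nx] := nextP (w j).+1.
have wx : w j < x by rewrite ltnNge; apply/negP => /jmin; lia.
by move: (nx wx) xw; rewrite /w /= -/(w j); lia.
Qed.

(** * Weaving special vertices and blocks *)

(** Position [q * k] carries a special vertex and the [k.-1] positions after it a block. With
    integer positions, the cycle, the one-way and the two-way path differ only in the choice of [V]
    and [L]. *)
Definition weave (k : nat) (w : nat -> nat) (B : nat -> nat -> nat)
    (V L : int -> nat) (z : int) : nat :=
  if (z %% k%:Z)%Z == 0%R then w (V (z %/ k%:Z)%Z)
  else B (L (z %/ k%:Z)%Z) `|(z %% k%:Z)%Z|%N.-1.

Lemma weaveE (k : nat) w B V L (q : int) (s : nat) : s < k ->
  weave k w B V L (q * k%:Z + s%:Z)%R =
  if s == 0 then w (V q) else B (L q) s.-1.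
Proof.
move=> sk; have k0 : (k%:Z != 0)%R by lia.
have sk' : (0 <= s%:Z < `|k%:Z|)%R by lia.
rewrite /weave modzMDl divzMDl // modz_small // divz_small // GRing.addr0.
by case: s sk sk'.
Qed.

Lemma int_split (k : nat) (z : int) : 0 < k ->
  exists q (s : nat), s < k /\ z = (q * k%:Z + s%:Z)%R.
Proof.
move=> k0; exists (z %/ k%:Z)%Z, `|(z %% k%:Z)%Z|%N.
have k0' : (k%:Z != 0)%R by lia.
have := modz_ge0 z k0'; have := ltz_pmod z (_ : (0 < k%:Z)%R).
have := divz_eq z k%:Z; lia.
Qed.

(** [D] delimits the stretch that is listed: one period for a cycle, the naturals for a one-way
    path, everything for a two-way path. *)
Lemma weave_inj (k : nat) (hk : 0 < k) w B V L (D : int -> Prop)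
  (wVinj : forall q q', D q -> D q' -> w (V q) = w (V q') -> q = q')
  (BLinj : forall q q' t t', D q -> D q' -> t < k.-1 -> t' < k.-1 ->
     B (L q) t = B (L q') t' -> q = q' /\ t = t')
  (wB : forall q q' t, D q -> D q' -> t < k.-1 -> w (V q) <> B (L q') t)
  (q q' : int) (s s' : nat) :
  D q -> D q' -> s < k -> s' < k ->
  weave k w B V L (q * k%:Z + s%:Z)%R = weave k w B V L (q' * k%:Z + s'%:Z)%R ->
  q = q' /\ s = s'.
Proof.
move=> Dq Dq' sk sk'; rewrite !weaveE //.
case: s sk => [|s] sk; case: s' sk' => [|s'] sk' //=.
- by move/(wVinj _ _ Dq Dq').
- by move/wB => []//; lia.
- by move/esym/wB => []//; lia.
- by move/BLinj => -[]//; [lia|lia|move=> -> ->].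
Qed.

Lemma weave_image (k : nat) (hk : 0 < k) w B V L (D : int -> Prop) x :
  (exists q s, [/\ D q, s < k & x = weave k w B V L (q * k%:Z + s%:Z)%R]) <->
  (exists2 q, D q & x = w (V q)) \/
  (exists q t, [/\ D q, t < k.-1 & x = B (L q) t]).
Proof.
split=> [[q [s [Dq sk]]]|[[q Dq ->]|[q [t [Dq tk ->]]]]].
- rewrite weaveE //; case: s sk => [|s] sk ->; first by left; exists q.
  by right; exists q, s; split=> //; lia.
- by exists q, 0; split=> //; rewrite weaveE.
- by exists q, t.+1; split=> //; [lia|rewrite weaveE //; lia].
Qed.

(* A window of length [k] contains exactly one position divisible by [k]. *)
Lemma weave_window (k : nat) (hk : 0 < k) w B V L
    (linked : nat -> nat -> Prop) (Q : seq nat -> Prop)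
    (hom : forall b l l' s, linked b l -> linked b l' -> uniq s ->
       size s = k -> w b \in s ->
       (forall x, x \in s -> x <> w b ->
          exists2 t, t < k.-1 & x = B l t \/ x = B l' t) -> Q s)
    (z : int) (s : seq nat) :
  s = [seq weave k w B V L (z + j%:Z)%R | j <- iota 0 k] -> uniq s ->
  (forall q : int, (z <= q * k%:Z < z + k%:Z)%R -> linked (V q) (L q) /\
     ((z < q * k%:Z)%R -> linked (V q) (L (q - 1)%R))) -> Q s.
Proof.
move=> sE us link.
(* The multiple [q * k] sits at offset [d] in the window. The entries before it are the end of block
   [L (q - 1)], those after it the beginning of block [L q]. *)
have [q [d [dk zE]]] : exists q (d : nat), d < k /\ (z = q * k%:Z - d%:Z)%R.
  have [q [e [ek zE]]] := int_split z hk.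
  case: e ek zE => [|e] ek ->; first by exists q, 0; split=> //; lia.
  by exists (q + 1)%R, (k - e.+1); split; lia.
have [lq lq1] : linked (V q) (L q) /\
    ((z < q * k%:Z)%R -> linked (V q) (L (q - 1)%R)) by apply: link; lia.
have wE j : j < k -> weave k w B V L (z + j%:Z)%R =
    if j < d then B (L (q - 1)%R) (k + j - d).-1 else
    if j == d then w (V q) else B (L q) (j - d).-1.
  move=> jk; case: ifP => jd.
    have -> : (z + j%:Z = (q - 1) * k%:Z + (k + j - d)%:Z)%R by lia.
    by rewrite weaveE; [case: ifP => //; lia|lia].
  have -> : (z + j%:Z = q * k%:Z + (j - d)%:Z)%R by lia.
  rewrite weaveE; last by lia.
  have -> : (j - d == 0) = (j == d) by lia.
  by [].
(* A window that starts at its special vertex meets only one block, and the link to the preceding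
   block is then not provided. *)
pose l' := if d == 0 then L q else L (q - 1)%R.
apply: (hom (V q) (L q) l') => //.
- by rewrite /l'; case: ifP => // d0; apply: lq1; lia.
- by rewrite sE size_map size_iota.
- rewrite sE; apply/mapP; exists d; first by rewrite mem_iota; lia.
  by rewrite wE // ltnn eqxx.
- move=> x; rewrite sE => /mapP[j]; rewrite mem_iota => jk ->.
  rewrite wE; last by lia.
  case: ifP => jd; last case: ifP => jd' // _.
    move=> _; exists (k + j - d).-1; first by lia.
    by right; rewrite /l'; case: ifP => //; lia.
  by exists (j - d).-1; [lia|left].
Qed.

(** * Cycles, one-way and two-way paths *)

(** This turns the cycle of a finitely used color into its path: a window that fits into [s] without
    wrapping around begins some rotation of [s]. *)
Lemma cycle_is_path (k r : nat) (hk : 0 < k) (c : edge k -> 'I_r) i s :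
  monochromatic_cycle c i (Cycle s) -> monochromatic_path c i (FinPath s).
Proof.
move=> [us cs]; split=> //; right=> n nk.
have ns : n < size s by lia.
have := cs n ns; rewrite /rot takel_cat // size_drop; lia.
Qed.

(* [J] is the set of indices in use; [w j], [J j], are the special vertices and
   [B l t], [t < k.-1], the vertices of the [l]-th connecting block. *)
Definition piece_vertices (k : nat) (J : nat -> Prop) (w : nat -> nat)
    (B : nat -> nat -> nat) : set nat :=
  [set x | (exists2 j, J j & x = w j) \/
           (exists l t, [/\ J l, t < k.-1 & x = B l t])]%classic.

(** With indices taken modulo [m], the weave is periodic, and [s] is one period of it. Here [hom]
    allows every special vertex next to every block, so the ends can be joined. *)
Lemma cycle_piece_exists (k r : nat) (hk : 0 < k) (c : edge k -> 'I_r) i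
    (m : nat) (w : nat -> nat) (B : nat -> nat -> nat)
  (winj : forall j j', j < m -> j' < m -> w j = w j' -> j = j')
  (Binj : forall l l' t t', l < m -> l' < m -> t < k.-1 -> t' < k.-1 ->
     B l t = B l' t' -> l = l' /\ t = t')
  (wB : forall j l t, j < m -> l < m -> t < k.-1 -> w j <> B l t)
  (hom : forall b l l' s, b < m /\ l < m -> b < m /\ l' < m -> uniq s ->
     size s = k -> w b \in s ->
     (forall x, x \in s -> x <> w b ->
        exists2 t, t < k.-1 & x = B l t \/ x = B l' t) -> edge_of_color c i s) :
  exists s, monochromatic_cycle c i (Cycle s) /\
    [set` s]%classic = piece_vertices k (fun j => j < m) w B.
Proof.
case: (posnP m) => [m0|m0].
  exists [::]; split=> //; apply/seteqP; split=> x //=.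
  by case=> [[j]|[l [t []]]]; rewrite m0.
pose V (q : int) := `|(q %% m%:Z)%Z|%N.
have Vm q : V q < m.
  have m0' : (m%:Z != 0)%R by lia.
  by rewrite /V; have := modz_ge0 q m0'; have := ltz_pmod q (_ : (0 < m%:Z)%R); lia.
have Vsmall (q : nat) : q < m -> V q%:Z = q.
  by move=> qm; rewrite /V modz_small //; lia.
pose F := weave k w B V V.
pose D (q : int) := exists2 n : nat, q = n%:Z & n < m.
have Finj := @weave_inj k hk w B V V D.
have {}Finj : forall q q' s s', D q -> D q' -> s < k -> s' < k ->
  F (q * k%:Z + s%:Z)%R = F (q' * k%:Z + s'%:Z)%R -> q = q' /\ s = s'.
  apply: Finj.
  - move=> q q' [n -> nm] [n' -> nm']; rewrite !Vsmall // => /winj -> //.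
  - move=> q q' t t' [n -> nm] [n' -> nm'] tk tk'; rewrite !Vsmall // => /Binj.
    by case=> // -> ->.
  - by move=> q q' t _ _ tk; apply: wB.
pose s := [seq F p%:Z | p <- iota 0 (m * k)].
have sz : size s = m * k by rewrite size_map size_iota.
have us : uniq s.
  rewrite map_inj_in_uniq ?iota_uniq // => p p'; rewrite !mem_iota /= => pm pm'.
  rewrite (divn_eq p k) (divn_eq p' k) !PoszD !PoszM => /Finj[].
  - by exists (p %/ k) => //; rewrite ltn_divLR; lia.
  - by exists (p' %/ k) => //; rewrite ltn_divLR; lia.
  - exact: ltn_pmod.
  - exact: ltn_pmod.
  - by move=> [->] ->.
(* By periodicity, a window of [s] that wraps around is the window of [F] that runs on past
   [m * k]. *)
have Fper z : F (z + (m * k)%:Z)%R = F z.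
  have [q [t [tk ->]]] := int_split z hk.
  have -> : (q * k%:Z + t%:Z + (m * k)%:Z = (q + m%:Z) * k%:Z + t%:Z)%R by lia.
  by rewrite /F !weaveE // /V modzDr.
exists s; split; first split=> // n ns.
  have kmk : k <= m * k by rewrite leq_pmull.
  have tE : take k (rot n s) = [seq F (n%:Z + j%:Z)%R | j <- iota 0 k].
    apply: (@eq_from_nth _ 0).
      by rewrite size_takel ?size_rot ?sz // size_map size_iota.
    move=> j; rewrite size_takel ?size_rot ?sz // => jk.
    rewrite nth_take // (nth_map 0) ?size_iota // nth_iota // add0n.
    rewrite /rot nth_cat size_drop sz; case: ifP => jn.
      rewrite nth_drop (nth_map 0) ?size_iota ?nth_iota; try lia.
      by rewrite add0n PoszD.
    rewrite nth_take; last by lia.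
    rewrite (nth_map 0) ?size_iota ?nth_iota; try lia.
    by rewrite add0n -Fper; congr F; lia.
  apply: (weave_window hk hom tE).
    by rewrite take_uniq // rot_uniq.
  by move=> q _; split=> [|_]; split; apply: Vm.
apply/seteqP; split=> x /=.
  move=> /mapP[p]; rewrite mem_iota => pm ->.
  have : exists q t, [/\ D q, t < k & F p%:Z = F (q * k%:Z + t%:Z)%R].
    exists (p %/ k)%:Z, (p %% k); split; last by rewrite -PoszM -PoszD -divn_eq.
      by exists (p %/ k) => //; rewrite ltn_divLR; lia.
    exact: ltn_pmod.
  case/weave_image => // [[q Dq ->]|[q [t [Dq tk ->]]]]; [left|right].
    by exists (V q).
  by exists (V q), t.
move=> xP; have : exists q t, [/\ D q, t < k & x = F (q * k%:Z + t%:Z)%R].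
  apply/weave_image => //; case: xP => [[j jm ->]|[l [t [lm tk ->]]]]; [left|right].
    by exists j%:Z; [exists j|rewrite Vsmall].
  by exists l%:Z, t; split=> //; [exists l|rewrite Vsmall].
case=> q [t [[n -> nm] tk ->]]; apply/mapP; exists (n * k + t); last first.
  by rewrite PoszD PoszM.
by rewrite mem_iota /= add0n; have := leq_mul nm (leqnn k); lia.
Qed.

(** The order is [w 0], [B 0], [w 1], [B 1], and so on: [w b] has only the blocks [b - 1] and [b] as
    neighbors, whence the condition [b <= l.+1] in [hom]. *)
Lemma one_way_piece (k r : nat) (hk : 0 < k) (c : edge k -> 'I_r) i
    (w : nat -> nat) (B : nat -> nat -> nat)
  (winj : forall j j', w j = w j' -> j = j')
  (Binj : forall l l' t t', t < k.-1 -> t' < k.-1 ->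
     B l t = B l' t' -> l = l' /\ t = t')
  (wB : forall j l t, t < k.-1 -> w j <> B l t)
  (hom : forall b l l' s, b <= l.+1 -> b <= l'.+1 -> uniq s ->
     size s = k -> w b \in s ->
     (forall x, x \in s -> x <> w b ->
        exists2 t, t < k.-1 & x = B l t \/ x = B l' t) -> edge_of_color c i s) :
  exists f, monochromatic_path c i (OneWayPath f) /\
    range f = piece_vertices k (fun=> True) w B.
Proof.
pose F := weave k w B absz absz; pose D (q : int) := exists n : nat, q = n%:Z.
have Finj : forall q q' s s', D q -> D q' -> s < k -> s' < k ->
    F (q * k%:Z + s%:Z)%R = F (q' * k%:Z + s'%:Z)%R -> q = q' /\ s = s'.
  apply: weave_inj => //.
  - by move=> q q' [n ->] [n' ->] /winj /= ->.
  - by move=> q q' t t' [n ->] [n' ->] tk tk' /Binj; case=> // /= -> ->.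
  - by move=> q q' t _ _ tk; apply: wB.
have finj : injective (fun n : nat => F n%:Z).
  move=> p p'; rewrite (divn_eq p k) (divn_eq p' k) !PoszD !PoszM => /Finj[].
  - by exists (p %/ k).
  - by exists (p' %/ k).
  - exact: ltn_pmod.
  - exact: ltn_pmod.
  - by move=> [->] ->.
exists (fun n => F n%:Z); split; first split=> // n.
  apply: (weave_window hk (linked := fun b l => b <= l.+1) hom (z := n%:Z) erefl).
    rewrite map_inj_in_uniq ?iota_uniq // => p p' _ _ /finj; exact: addnI.
  by move=> q nq; split=> [|nq']; nia.
apply/seteqP; split=> x.
  move=> [p _ <-].
  have : exists q t, [/\ D q, t < k & F p%:Z = F (q * k%:Z + t%:Z)%R].
    exists (p %/ k)%:Z, (p %% k); split; last by rewrite -PoszM -PoszD -divn_eq.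
      by exists (p %/ k).
    exact: ltn_pmod.
  case/weave_image => // [[q Dq ->]|[q [t [Dq tk ->]]]]; [left|right].
    by exists `|q|%N.
  by exists `|q|%N, t.
move=> xP; have : exists q t, [/\ D q, t < k & x = F (q * k%:Z + t%:Z)%R].
  apply/weave_image => //; case: xP => [[j jm ->]|[l [t [lm tk ->]]]]; [left|right].
    by exists j%:Z; [exists j|].
  by exists l%:Z, t; split=> //; exists l.
by case=> q [t [[n ->] tk ->]]; exists (n * k + t) => //; rewrite PoszD PoszM.
Qed.

(* The special vertices appear in the order ..., w_4, w_2, w_0, w_1, w_3, ...;
   the block following position [q] comes with [zigzag_block q]. *)
Definition zigzag (q : int) : nat :=
  match q with
  | Posz 0 => 0
  | Posz m.+1 => m.*2.+1
  | Negz m => m.*2.+2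
  end.

Definition zigzag_block (q : int) : nat :=
  match q with Posz m => m.*2 | Negz m => m.*2.+1 end.

Lemma zigzag_inj : injective zigzag.
Proof. by case=> [[|m]|m] [[|m']|m'] //= e; lia. Qed.

Lemma zigzag_surj n : exists q, zigzag q = n.
Proof.
case: n => [|n]; first by exists (Posz 0).
have [on|en] := boolP (odd n).
  by exists (Negz n./2); rewrite /=; lia.
by exists (Posz n./2.+1); rewrite /=; lia.
Qed.

Lemma zigzag_block_inj : injective zigzag_block.
Proof. by case=> m [] m' //= e; lia. Qed.

Lemma zigzag_block_surj n : exists q, zigzag_block q = n.
Proof.
have [on|en] := boolP (odd n).
  by exists (Negz n./2); rewrite /=; lia.
by exists (Posz n./2); rewrite /=; lia.
Qed.

(** The order is ..., [w 4], [B 3], [w 2], [B 1], [w 0], [B 0], [w 1], [B 2], [w 3], ...: although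
    it runs both ways, [w b] still meets only blocks numbered at least [b - 1], as in the one-way
    path. *)
Lemma zigzag_linkr q : zigzag q <= (zigzag_block q).+1.
Proof. by case: q => [[|m]|m] /=; lia. Qed.

Lemma zigzag_linkl q : zigzag q <= (zigzag_block (q - 1)%R).+1.
Proof.
case: q => [[|m]|m] //.
  by have -> : (Posz m.+1 - 1 = m%:Z)%R by lia.
have -> : (Negz m - 1 = Negz m.+1)%R by lia.
by rewrite /=; lia.
Qed.

Lemma two_way_piece (k r : nat) (hk : 0 < k) (c : edge k -> 'I_r) i
    (w : nat -> nat) (B : nat -> nat -> nat)
  (winj : forall j j', w j = w j' -> j = j')
  (Binj : forall l l' t t', t < k.-1 -> t' < k.-1 ->
     B l t = B l' t' -> l = l' /\ t = t')
  (wB : forall j l t, t < k.-1 -> w j <> B l t)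
  (hom : forall b l l' s, b <= l.+1 -> b <= l'.+1 -> uniq s ->
     size s = k -> w b \in s ->
     (forall x, x \in s -> x <> w b ->
        exists2 t, t < k.-1 & x = B l t \/ x = B l' t) -> edge_of_color c i s) :
  exists f, monochromatic_cycle c i (TwoWayPath f) /\
    range f = piece_vertices k (fun=> True) w B.
Proof.
pose F := weave k w B zigzag zigzag_block.
have FK : forall q q' s s', True -> True -> s < k -> s' < k ->
    F (q * k%:Z + s%:Z)%R = F (q' * k%:Z + s'%:Z)%R -> q = q' /\ s = s'.
  apply: (@weave_inj k hk w B zigzag zigzag_block (fun=> True)).
  - by move=> q q' _ _ /winj/zigzag_inj.
  - by move=> q q' t t' _ _ tk tk' /Binj; case=> // /zigzag_block_inj.
  - by move=> q q' t _ _ tk; apply: wB.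
have Finj : injective F.
  move=> z z'; have [q [s [sk ->]]] := int_split z hk.
  have [q' [s' [sk' ->]]] := int_split z' hk.
  by move=> /FK[] // -> ->.
exists F; split; first split=> // z.
  apply: (weave_window hk (linked := fun b l => b <= l.+1) hom (z := z) erefl).
    by rewrite map_inj_in_uniq ?iota_uniq // => p p' _ _ /Finj; lia.
  by move=> q _; split=> [|_]; [exact: zigzag_linkr|exact: zigzag_linkl].
apply/seteqP; split=> x.
  move=> [z _ <-]; have [q [s [sk ->]]] := int_split z hk.
  have : exists q' t, [/\ True, t < k &
      F (q * k%:Z + s%:Z)%R = F (q' * k%:Z + t%:Z)%R] by exists q, s.
  case/weave_image => // [[q' _ ->]|[q' [t [_ tk ->]]]]; [left|right].
    by exists (zigzag q').
  by exists (zigzag_block q'), t.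
move=> xP; have : exists q t, [/\ True, t < k & x = F (q * k%:Z + t%:Z)%R].
  apply/(@weave_image k hk w B zigzag zigzag_block (fun=> True)).
  case: xP => [[j jm ->]|[l [t [lm tk ->]]]]; [left|right].
    by have [q <-] := zigzag_surj j; exists q.
  by have [q <-] := zigzag_block_surj l; exists q, t.
by case=> q [t [_ tk ->]]; exists (q * k%:Z + t%:Z)%R.
Qed.

(** * Distribution of the generic terms among the blocks *)

(** A mixed radix code of color, block number and place in the block. The shift by 3 puts block [l]
    beyond [g l.+2], hence beyond [w b <= g b.+1] whenever [b <= l.+1]. *)
Definition slot (k r i l t : nat) : nat := (l * r + i + 3) * k + t.

Lemma slot_inj (k r i i' l l' t t' : nat) : i < r -> i' < r ->
  t < k -> t' < k -> slot k r i l t = slot k r i' l' t' ->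
  [/\ i = i', l = l' & t = t'].
Proof.
move=> ir ir' tk tk' e.
have k0 : 0 < k by lia.
have r0 : 0 < r by lia.
have et : t = t'.
  by have := congr1 (modn^~ k) e; rewrite /slot !modnMDl !modn_small.
have eq : l * r + i = l' * r + i'.
  have := congr1 (divn^~ k) e; rewrite /slot !divnMDl // !divn_small //; lia.
have ei : i = i'.
  by have := congr1 (modn^~ r) eq; rewrite !modnMDl !modn_small.
have := congr1 (divn^~ r) eq; rewrite !divnMDl // !divn_small // !addn0.
by move=> ->.
Qed.

Lemma slot_gt (k r i l t n : nat) : 0 < k -> 0 < r -> n <= l.+2 ->
  n < slot k r i l t.
Proof.
rewrite /slot => k0 r0 nl; have := leq_pmulr l r0.
by have := leq_pmulr (l * r + i + 3) k0; lia.
Qed.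

Lemma card_seq_fset (s : seq nat) : uniq s -> #|` [fset x in s]%fset| = size s.
Proof. by move=> us; rewrite card_fseq undup_id. Qed.

Lemma exists_color_pieces (k r : nat) (hk : 0 < k) (hr : 0 < r)
    (c : edge k -> 'I_r) (i : 'I_r) (a : nat -> 'I_r) (g : nat -> nat)
    (used : nat -> Prop) (inf : Prop) (m : nat) (w : nat -> nat)
    (J := fun j => inf \/ j < m) (B := fun l t => g (slot k r i l t))
  (ginj : injective g)
  (gcolor : forall n v s, uniq s -> size s = k -> v \in s -> v <= g n ->
     (forall x, x \in s -> x <> v -> exists2 p, n < p & x = g p) ->
     edge_of_color c (a v) s)
  (usedB : forall l t, J l -> t < k.-1 -> used (B l t))
  (winj : forall j j', J j -> J j' -> w j = w j' -> j = j')
  (wP : forall j, J j -> a (w j) = i /\ ~ used (w j))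
  (winf : inf -> forall j, w j <= g j.+1)
  (wfin : ~ inf -> forall j, j < m -> w j <= g 0) :
  (exists p : path_piece, monochromatic_path c i p /\
     path_vertices p = piece_vertices k J w B) /\
  (exists p : cycle_piece, monochromatic_cycle c i p /\
     cycle_vertices p = piece_vertices k J w B).
Proof.
have Binj l l' t t' : t < k.-1 -> t' < k.-1 -> B l t = B l' t' ->
    l = l' /\ t = t'.
  by move=> tk tk' /ginj/slot_inj[]//; lia.
have wB j l t : J j -> J l -> t < k.-1 -> w j <> B l t.
  by move=> Jj Jl tk e; have [_] := wP j Jj; apply; rewrite e; apply: usedB.
(* The index [n] separates [w b] from both blocks: they consist of terms after [g n], so the window
   has the color of [w b], which is [i]. *)
have hom n b l l' s : J b -> w b <= g n -> n <= l.+2 -> n <= l'.+2 -> uniq s ->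
     size s = k -> w b \in s ->
     (forall x, x \in s -> x <> w b ->
        exists2 t, t < k.-1 & x = B l t \/ x = B l' t) -> edge_of_color c i s.
  move=> Jb bn nl nl' us sk bs sP; have [<- _] := wP b Jb.
  apply: (gcolor n) => // x xs xb; have [t tk [->|->]] := sP x xs xb.
    by exists (slot k r i l t) => //; apply: slot_gt.
  by exists (slot k r i l' t) => //; apply: slot_gt.
have [ii|ni] := pselect inf.
  have JT j : J j by left.
  have -> : J = fun=> True by apply/funext => j; apply/propext; split.
  have hom' : forall b l l' s, b <= l.+1 -> b <= l'.+1 -> uniq s ->
     size s = k -> w b \in s ->
     (forall x, x \in s -> x <> w b ->
        exists2 t, t < k.-1 & x = B l t \/ x = B l' t) -> edge_of_color c i s.
    by move=> b l l' s bl bl'; apply: (hom b.+1) => //; apply: winf.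
  split.
    have [|||f [fP fE]] := @one_way_piece k r hk c i w B _ _ _ hom'.
    - by move=> j j'; apply: winj.
    - by move=> l l' t t'; apply: Binj.
    - by move=> j l t; apply: wB.
    by exists (OneWayPath f).
  have [|||f [fP fE]] := @two_way_piece k r hk c i w B _ _ _ hom'.
  - by move=> j j'; apply: winj.
  - by move=> l l' t t'; apply: Binj.
  - by move=> j l t; apply: wB.
  by exists (TwoWayPath f).
have JE j : j < m -> J j by right.
have -> : J = fun j => j < m.
  by apply/funext => j; apply/propext; split=> [[]|/JE].
have [||||s [sP sE]] := @cycle_piece_exists k r hk c i m w B.
- by move=> j j' jm jm'; apply: winj; apply: JE.
- by move=> l l' t t' _ _; apply: Binj.
- by move=> j l t jm lm; apply: wB; apply: JE.
(* All special vertices lie below [g 0], which precedes every block. *)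
- move=> b l l' s [bm _] _; apply: (hom 0) => //; first exact: JE.
  exact: wfin.
by split; [exists (FinPath s); split=> //; apply: cycle_is_path|exists (Cycle s)].
Qed.

(** * Assembly of the partition *)

Theorem theorem3p3 (k r : nat) (hk : 0 < k) (hr : 0 < r) (c : edge k -> 'I_r) :
  (exists P : 'I_r -> path_piece,
     (forall i, monochromatic_path c i (P i)) /\
     is_partition (fun i => path_vertices (P i))) /\
  (exists P : 'I_r -> cycle_piece,
     (forall i, monochromatic_cycle c i (P i)) /\
     is_partition (fun i => cycle_vertices (P i))).
Proof.
have [col [colc colgen]] := extend_coloring hr c.
pose a v := col [fset v]%fset.
have [g [gS ggen ggap gfin]] := exists_spread_sequence a colgen.
have ginj := increasing_inj gS.
have gcolor n v s : uniq s -> size s = k -> v \in s -> v <= g n ->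
    (forall x, x \in s -> x <> v -> exists2 p, n < p & x = g p) ->
    edge_of_color c (a v) s.
  move=> us sk vs vn sP.
  have cs : #|` [fset x in s]%fset| == k by rewrite card_seq_fset // sk.
  exists (exist _ [fset x in s]%fset cs); split=> //.
  rewrite -colc /=; apply: (generic_color gS ggen _ vn).
  - by rewrite inE.
  - by rewrite (eqP cs).
  - by move=> x; rewrite inE; apply: sP.
pose inf i := infinite_class a i.
(* For a finitely used color this is its entire class, since [g 0] bounds it; it meets no block, as
   the blocks start after [g 0]. *)
pose cls (i : 'I_r) := [seq x <- iota 0 (g 0).+1 | a x == i].
pose J i j := inf i \/ j < size (cls i).
pose B (i : 'I_r) l t := g (slot k r i l t).
pose used x := exists i l t, [/\ J i l, t < k.-1 & x = B i l t].
have wex i : exists w : nat -> nat,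
    [/\ forall j j', J i j -> J i j' -> w j = w j' -> j = j',
        forall x, a x = i /\ ~ used x <-> exists2 j, J i j & x = w j,
        inf i -> forall j, w j <= g j.+1
      & ~ inf i -> forall j, j < size (cls i) -> w j <= g 0].
  have [ii|ni] := pselect (inf i).
    have [|w [wS wg wP]] :=
        @enumerate_class (fun x => a x = i /\ ~ used x) g.
      (* A vertex strictly between consecutive terms of [g] is not a term of [g], so it lies in no
         block. *)
      move=> n; have [x axi xn] := ggap i ii n; exists x => //; split=> //.
      move=> [i' [l [t [_ _ xE]]]]; move: xn; rewrite xE => /andP[np pn].
      have [sn|ns] := leqP (slot k r i' l t) n.
        by have := increasing_leq gS sn; rewrite /B in np; lia.
      by have := increasing_leq gS ns; rewrite /B in pn; lia.
    exists w; split=> // [j j' _ _|x]; first exact: increasing_inj.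
    by rewrite wP; split=> [[j ->]|[j _ ->]]; exists j => //; left.
  exists (nth 0 (cls i)); split=> //.
  - move=> j j' [//|jm] [//|jm'] /eqP; rewrite nth_uniq ?filter_uniq ?iota_uniq //.
    by move/eqP.
  - move=> x; split=> [[axi _]|[j [//|jm] ->]].
      have xc : x \in cls i.
        rewrite mem_filter axi eqxx mem_iota /= add0n ltnS.
        by apply: gfin; rewrite axi.
      by exists (index x (cls i)); [right; rewrite index_mem|rewrite nth_index].
    have := mem_nth 0 jm; rewrite mem_filter mem_iota /= add0n ltnS.
    move=> /andP[/eqP axi xg]; split=> // -[i' [l [t [_ _ xE]]]].
    have : g 0 < B i' l t.
      by apply: leq_trans (gS 0) (increasing_leq gS _); apply: slot_gt.
    by rewrite -xE; lia.
  - move=> _ j jm; have := mem_nth 0 jm.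
    by rewrite mem_filter mem_iota /= add0n ltnS => /andP[].
have [w wP] := choice wex.
pose Vs i := piece_vertices k (J i) (w i) (B i).
(* A vertex of a block goes to the piece owning the block, whatever its own color; any other vertex
   goes to the piece of its color. Injectivity of [slot] makes the owner unique. *)
have Vpart : is_partition Vs.
  split.
    apply/seteqP; split=> // x _.
    have [[i [l [t [Jl tk xE]]]]|nu] := pselect (used x).
      by exists i => //; right; exists l, t.
    exists (a x) => //; left; have [_ wx _ _] := wP (a x).
    by apply/wx.
  move=> i i' _ _ [x [xi xi']].
  have Vx i0 : Vs i0 x -> a x = i0 /\ ~ used x \/
      exists l t, [/\ J i0 l, t < k.-1 & x = B i0 l t].
    by case=> [wx|?]; [left; have [_ h _ _] := wP i0; apply/h|right].
  case: (Vx i xi) (Vx i' xi') => [[ai nu]|[l [t [Jl tk xE]]]].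
    case=> [[ai' _]|[l [t xE]]]; first by rewrite -ai -ai'.
    by case: nu; exists i', l, t.
  case=> [[_ []]|[l' [t' [Jl' tk' xE']]]]; first by exists i, l, t.
  apply/val_inj; move: xE'; rewrite xE => /ginj/slot_inj[] //; lia.
have pieces i : (exists p : path_piece, monochromatic_path c i p /\
     path_vertices p = Vs i) /\ (exists p : cycle_piece,
     monochromatic_cycle c i p /\ cycle_vertices p = Vs i).
  have [winj wx winf wfin] := wP i.
  apply: (exists_color_pieces hk hr (used := used) ginj gcolor _ winj _ winf wfin).
  - by move=> l t Jl tk; exists i, l, t.
  - by move=> j Jj; apply/wx; exists j.
have /choice[p pP] : forall i, exists p : path_piece,
    monochromatic_path c i p /\ path_vertices p = Vs i.
  by move=> i; have [] := pieces i.
have /choice[q qP] : forall i, exists q : cycle_piece,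
    monochromatic_cycle c i q /\ cycle_vertices q = Vs i.
  by move=> i; have [] := pieces i.
split; [exists p|exists q]; (split; first by move=> i; have [] := pP i; have [] := qP i).
- by have -> : (fun i => path_vertices (p i)) = Vs
    by apply/funext => i; have [] := pP i.
- by have -> : (fun i => cycle_vertices (q i)) = Vs
    by apply/funext => i; have [] := qP i.
Qed.
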